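(* Fix an imprecise probabilities tree with finite state space $\mathscr{X}$ and local upper expectations $\overline{\mathrm{Q}}_s$, $s\in\mathscr{X}^{\ast}$, and let $\overline{\mathrm{E}}_{\mathrm V}$ be the corresponding game-theoretic upper expectation. For any $n\in\mathbb{N}_0$, any situation $x_{1:n}\in\mathscr{X}^{n}$ and any $(n+1)$-measurable extended real variable $f\colon\Omega\to\overline{\mathbb{R}}$ that is bounded below, \[\overline{\mathrm{E}}_{\mathrm V}(f\vert x_{1:n})=\overline{\mathrm{Q}}_{x_{1:n}}(f(x_{1:n}\,\cdot)).\]
   Context: Notation: $\mathbb{N}=\{1,2,\dots\}$, $\mathbb{N}_0=\mathbb{N}\cup\{0\}$, $\overline{\mathbb{R}}=\mathbb{R}\cup\{-\infty,+\infty\}$, with conventions $+\infty-\infty=-\infty+\infty=+\infty$, $0\cdot(\pm\infty)=0$, $\inf\emptyset=+\infty$. For a non-empty set $\mathscr{Y}$, $\overline{\mathscr{L}}(\mathscr{Y})$ is the set of all maps $\mathscr{Y}\to\overline{\mathbb{R}}$ and $\overline{\mathscr{L}}_b(\mathscr{Y})$ the subset of those bounded below by a real constant. Limits and inequalities of functions are pointwise. Local models: $\mathscr{X}$ is a finite non-empty set. $\mathscr{X}^{\ast}=\bigcup_{n\in\mathbb{N}_0}\mathscr{X}^n$ is the set of situations (finite strings, including the empty string $\Box$). An imprecise probabilities tree assigns to each $s\in\mathscr{X}^{\ast}$ a map $\overline{\mathrm{Q}}_s\colon\overline{\mathscr{L}}(\mathscr{X})\to\overline{\mathbb{R}}$ that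 is an upper expectation, i.e. satisfies: (E1) $\overline{\mathrm{Q}}_s(c)=c$ for all $c\in\mathbb{R}$; (E2) $\overline{\mathrm{Q}}_s(f+g)\le\overline{\mathrm{Q}}_s(f)+\overline{\mathrm{Q}}_s(g)$ for all $f,g\in\overline{\mathscr{L}}_b(\mathscr{X})$; (E3) $\overline{\mathrm{Q}}_s(\lambda f)=\lambda\overline{\mathrm{Q}}_s(f)$ for all real $\lambda>0$ and $f\in\overline{\mathscr{L}}_b(\mathscr{X})$; (E4) $f\le g\Rightarrow\overline{\mathrm{Q}}_s(f)\le\overline{\mathrm{Q}}_s(g)$ for all $f,g\in\overline{\mathscr{L}}_b(\mathscr{X})$; (E5) $\lim_n\overline{\mathrm{Q}}_s(f_n)=\overline{\mathrm{Q}}_s(\lim_n f_n)$ for every non-decreasing sequence $\{f_n\}_{n\in\mathbb{N}_0}$ of non-negative variables in $\overline{\mathscr{L}}_b(\mathscr{X})$. Global model: $\Omega=\mathscr{X}^{\mathbb{N}}$ is the set of paths; for $\omega\in\Omega$, $\omega^n\in\mathscr{X}^n$ is the string of its first $n$ values; $\Gamma(x_{1:n})=\{\omega\in\Omega:\omega^n=x_{1:n}\}$. For $g,h\colon\Omega\to\overline{\mathbb{R}}$, $g\ge_s h$ means $g(\omega)\ge h(\omega)$ for all $\omega\in\Gamma(s)$. A supermartingale is a map $\mathscr{M}\colon\mathscr{X}^{\ast}\to\overline{\mathbb{R}}$ with $\overline{\mathrm{Q}}_s(\mathscr{M}(s\,\cdot))\le\mathscr{M}(s)$ for all $s\in\mathscr{X}^{\ast}$,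 where $\mathscr{M}(s\,\cdot)\in\overline{\mathscr{L}}(\mathscr{X})$ is $x\mapsto\mathscr{M}(sx)$. $\overline{\mathbb{M}}_{\mathrm b}$ is the set of supermartingales bounded below by a real constant, and $\liminf\mathscr{M}(\omega)=\liminf_{n\to+\infty}\mathscr{M}(\omega^n)$. The game-theoretic upper expectation is, for all $f\colon\Omega\to\overline{\mathbb{R}}$ and $s\in\mathscr{X}^{\ast}$, \[\overline{\mathrm{E}}_{\mathrm V}(f\vert s)=\inf\{\mathscr{M}(s):\mathscr{M}\in\overline{\mathbb{M}}_{\mathrm b},\ \liminf\mathscr{M}\ge_s f\}.\] A variable $f\colon\Omega\to\overline{\mathbb{R}}$ is $m$-measurable if $f(\omega)$ depends only on $\omega^m$; its constant value on $\Gamma(x_{1:m})$ is written $f(x_{1:m})$. For $x_{1:n}\in\mathscr{X}^n$ and $(n+1)$-measurable $f$, $f(x_{1:n}\,\cdot)\in\overline{\mathscr{L}}(\mathscr{X})$ is the map $x_{n+1}\mapsto f(x_{1:n+1})$. *)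

(* Defs.v *)
From mathcomp Require Export all_boot all_order all_algebra.
From mathcomp Require Export all_classical all_reals all_analysis.

Set Implicit Arguments.
Unset Strict Implicit.
Unset Printing Implicit Defensive.

Import Order.TTheory GRing.Theory Num.Theory.
Import numFieldNormedType.Exports.

Local Open Scope classical_set_scope.
Local Open Scope ring_scope.
Local Open Scope ereal_scope.

Definition bounded_below (R : realType) (Y : Type) (f : Y -> \bar R) : Prop :=
  exists c : R, forall y, c%:E <= f y.

(* The addition of extended reals is [dual_adde], for which
   [+oo + -oo = -oo + +oo = +oo]; the default addition of the library has
   [+oo + -oo = -oo].  The library product satisfies [0 * (+-oo) = 0]. *)
Record upper_expectation (R : realType) (X : finType)
    (Q : (X -> \bar R) -> \bar R) : Prop := UpperExpectation {
  upexp_cst : forall c : R, Q (fun=> c%:E) = c%:E ;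
  upexp_subadd : forall f g : X -> \bar R,
    bounded_below f -> bounded_below g ->
    Q (fun x => dual_adde (f x) (g x)) <= dual_adde (Q f) (Q g) ;
  upexp_scale : forall (l : R) (f : X -> \bar R),
    (0 < l)%R -> bounded_below f -> Q (fun x => l%:E * f x) = l%:E * Q f ;
  upexp_mono : forall f g : X -> \bar R,
    bounded_below f -> bounded_below g -> (forall x, f x <= g x) -> Q f <= Q g ;
  upexp_cvg : forall u : nat -> X -> \bar R,
    (forall k x, 0 <= u k x) -> (forall x, nondecreasing_seq (u ^~ x)) ->
    Q (u k) @[k --> \oo] --> Q (fun x => limn (u ^~ x)) }.

(* Situations are finite sequences [s : seq X], [Q s] is the local model at
   [s], and a path is a function [w : nat -> X] whose [k]-th state is
   [w k.-1]; thus [mkseq w k] is the string of its first [k] states. *)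

Definition cylinder (X : finType) (s : seq X) : set (nat -> X) :=
  [set w | mkseq w (size s) = s].

Definition supermartingale (R : realType) (X : finType)
    (Q : seq X -> (X -> \bar R) -> \bar R) (M : seq X -> \bar R) : Prop :=
  forall s, Q s (fun x => M (rcons s x)) <= M s.

Definition path_liminf (R : realType) (X : finType) (M : seq X -> \bar R)
    (w : nat -> X) : \bar R :=
  limn_einf (fun k => M (mkseq w k)).

Definition gt_upper_expectation (R : realType) (X : finType)
    (Q : seq X -> (X -> \bar R) -> \bar R) (f : (nat -> X) -> \bar R)
    (s : seq X) : \bar R :=
  ereal_inf [set M s | M in [set M : seq X -> \bar R |
    [/\ supermartingale Q M, bounded_below M &
        forall w, cylinder s w -> f w <= path_liminf M w]]].

Definition finitely_measurable (R : realType) (X : finType) (m : nat)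
    (f : (nat -> X) -> \bar R) : Prop :=
  forall w w' : nat -> X, mkseq w m = mkseq w' m -> f w = f w'.

(* [f (s .)]: the value of [f] on the cylinder of [rcons s x] is read off at
   the path that follows [rcons s x] and then stays in [x] forever; see
   [next_varE] below. *)
Definition next_var (R : realType) (X : finType) (f : (nat -> X) -> \bar R)
    (s : seq X) : X -> \bar R :=
  fun x => f (nth x (rcons s x)).

Lemma next_varE (R : realType) (X : finType) (f : (nat -> X) -> \bar R)
    (s : seq X) (x : X) (w : nat -> X) :
  finitely_measurable (size s).+1 f -> cylinder (rcons s x) w ->
  next_var f s x = f w.
Proof.
move=> mf; rewrite /cylinder /= size_rcons => ws; apply: mf.
by rewrite ws -(size_rcons s x) mkseq_nth.
Qed.

(* Main.v *)
(* Upper expectations dominate the minimum, so every situation has a child on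
   which a supermartingale [M] does not increase.  Following such children from
   [t] yields a path in the cylinder of [t] along which the limit inferior of
   [M] is at most [M t].  Hence [liminf M >= f] on the cylinder of [s] forces
   [M (s x) >= f (s x)] for every [x], and so [M s >= Q_s (f (s .))].  This
   bound is attained by the supermartingale that is [+oo] off the extensions of
   [s], equals [Q_s (f (s .))] at [s], and keeps the value [f (s x)] from [s x]
   onwards. *)
Require Import Defs.
From mathcomp Require Import all_boot all_order all_algebra.
From mathcomp Require Import all_classical all_reals all_analysis.

Set Implicit Arguments.
Unset Strict Implicit.
Unset Printing Implicit Defensive.

Import Order.TTheory.

Local Open Scope classical_set_scope.
Local Open Scope ereal_scope.

Lemma limn_einf_le_near (R : realType) (u : (\bar R)^nat) (l : \bar R) :
  (\forall k \near \oo, u k <= l) -> limn_einf u <= l.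
Proof.
move=> ul; rewrite limn_einf_lim; apply: lime_le; first exact: is_cvg_einfs.
apply: filterS ul => k; apply: le_trans.
by apply: ereal_inf_lbound; exists k => /=.
Qed.

Lemma limn_einf_ge_near (R : realType) (u : (\bar R)^nat) (l : \bar R) :
  (\forall k \near \oo, l <= u k) -> l <= limn_einf u.
Proof.
move=> [N _ lu]; rewrite limn_einf_lim; apply: lime_ge.
  exact: is_cvg_einfs.
exists N => // k /= Nk; apply: le_ereal_inf_tmp => _ [j /= kj <-].
by apply: lu => /=; exact: leq_trans Nk kj.
Qed.

(** For real [c] this is the normalisation axiom, and for [+oo] the bound is trivial. *)
Lemma upper_expectation_cst_le (R : realType) (X : finType)
    (Q : (X -> \bar R) -> \bar R) (HQ : upper_expectation Q) (c : \bar R) :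
  -oo < c -> Q (fun=> c) <= c.
Proof.
by case: c => [r| |] // _; [rewrite (upexp_cst HQ)|rewrite leey].
Qed.

(** Monotonicity compares [g] with each real constant below [c]. If [c] is [+oo], then [Q g] exceeds
    every real. *)
Lemma upper_expectation_ge (R : realType) (X : finType)
    (Q : (X -> \bar R) -> \bar R) (HQ : upper_expectation Q)
    (g : X -> \bar R) (c : \bar R) :
  bounded_below g -> (forall x, c <= g x) -> c <= Q g.
Proof.
move=> gb cg.
have Qr (r : R) : r%:E <= c -> r%:E <= Q g.
  move=> rc; rewrite -(upexp_cst HQ r); apply: (upexp_mono HQ) => //.
    by exists r.
  by move=> x; exact: le_trans rc (cg x).
case: c {cg} Qr => [r| |] Qr; [exact: Qr| |by rewrite leNye].
by rewrite (@eq_infty _ (Q g)) // => r; apply: Qr; rewrite leey.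
Qed.

(** As [X] is finite and non-empty, [g] has a minimiser [x], and [g] dominates the constant [g x],
    which may be [+oo]. *)
Lemma upper_expectation_exists_le (R : realType) (X : finType)
    (X_gt0 : (0 < #|X|)%N) (Q : (X -> \bar R) -> \bar R)
    (HQ : upper_expectation Q) (g : X -> \bar R) :
  bounded_below g -> exists x, g x <= Q g.
Proof.
move=> gb; have [x0 _] := card_gt0P X_gt0.
have [x _ gx] := @arg_minP _ _ _ x0 xpredT g isT.
by exists x; apply: upper_expectation_ge => // y; exact: gx.
Qed.

Lemma bounded_below_comp (R : realType) (Y Z : Type) (f : Y -> \bar R)
    (h : Z -> Y) : bounded_below f -> bounded_below (fun z => f (h z)).
Proof. by move=> [c cf]; exists c => z. Qed.

Lemma mkseq_leq_cat (T : Type) (w : nat -> T) (m k : nat) : (m <= k)%N ->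
  mkseq w k = mkseq w m ++ [seq w i | i <- iota m (k - m)].
Proof. by move=> mk; rewrite -{1}(subnKC mk) /mkseq iotaD map_cat. Qed.

Section Supermartingales.
Variables (R : realType) (X : finType) (X_gt0 : (0 < #|X|)%N).
Variable Q : seq X -> (X -> \bar R) -> \bar R.
Hypothesis HQ : forall s, upper_expectation (Q s).

Lemma supermartingale_path (M : seq X -> \bar R) (t : seq X) :
  supermartingale Q M -> bounded_below M ->
  exists2 w, cylinder t w & path_liminf M w <= M t.
Proof.
move=> MQ Mb.
have /choice[step Mstep] : forall u, exists x, M (rcons u x) <= M u.
  move=> u; have [x Mx] := upper_expectation_exists_le X_gt0 (HQ u)
    (bounded_below_comp (rcons u) Mb).
  by exists x; exact: le_trans Mx (MQ u).
(* [T k] is the situation reached from [t] after [k] chosen steps. The path [w] spells out [t] and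
   then the chosen states; the default [step t] of [nth] is never read. *)
pose T k := iter k (fun u => rcons u (step u)) t.
pose w i :=
  if (i < size t)%N then nth (step t) t i else step (T (i - size t)%N).
have wt : cylinder t w.
  apply: (@eq_from_nth _ (step t)); rewrite size_mkseq // => i it.
  by rewrite nth_mkseq // /w it.
exists w => //.
have wT k : mkseq w (size t + k)%N = T k.
  elim: k => [|k IH]; first by rewrite addn0.
  by rewrite addnS mkseqS IH /w ltnNge leq_addr /= addKn.
have MT k : M (T k) <= M t.
  by elim: k => // k; apply: le_trans; exact: Mstep.
apply: limn_einf_le_near; exists (size t) => // k /= tk.
by rewrite -(subnKC tk) wT.
Qed.

Variables (f : (nat -> X) -> \bar R) (s : seq X).
Hypothesis f_bnd : bounded_below f.
Hypothesis f_meas : finitely_measurable (size s).+1 f.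

Definition next_supermartingale (t : seq X) : \bar R :=
  if prefix s t then
    if drop (size s) t is x :: _ then next_var f s x
    else Q s (next_var f s)
  else +oo.

Lemma next_supermartingale_cat (u : seq X) :
  next_supermartingale (s ++ u) =
    if u is x :: _ then next_var f s x else Q s (next_var f s).
Proof. by rewrite /next_supermartingale prefix_prefix drop_size_cat. Qed.

Lemma next_var_bounded_below : bounded_below (next_var f s).
Proof. exact: bounded_below_comp f_bnd. Qed.

Lemma next_supermartingaleP : supermartingale Q next_supermartingale.
Proof.
move=> t; have [/prefixP[u ->]|st] := boolP (prefix s t); last first.
  (* The value at [t] is [+oo] here, also when [t] is a proper prefix of [s]. *)
  by rewrite {2}/next_supermartingale (negbTE st) leey.
under eq_fun do rewrite rcons_cat next_supermartingale_cat.
rewrite next_supermartingale_cat; case: u => [|y u] /=; first by rewrite cats0.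
(* Strictly beyond [s] all children carry the same value [next_var f s y], which is not [-oo]
   because [f] is bounded below. *)
have [c cf] := next_var_bounded_below.
have := lt_le_trans (ltNyr c) (cf y).
exact: (upper_expectation_cst_le (HQ (s ++ y :: u))).
Qed.

Lemma next_supermartingale_bounded_below : bounded_below next_supermartingale.
Proof.
have [c cf] := next_var_bounded_below; exists c => t.
rewrite /next_supermartingale; case: ifP => _; last by rewrite leey.
case: (drop _ _) => [|x _]; last exact: cf.
(* At [s] itself the lower bound [c] of [f] passes to [Q s]. *)
by apply: upper_expectation_ge => //; exact: next_var_bounded_below.
Qed.

Lemma next_supermartingale_liminf (w : nat -> X) :
  cylinder s w -> f w <= path_liminf next_supermartingale w.
Proof.
move=> ws; apply: limn_einf_ge_near; exists (size s).+1 => // k /= sk.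
(* Beyond length [size s], the prefix of [w] extends [s] by the state [w (size s)], so the value is
   constantly [f w]. *)
rewrite (mkseq_leq_cat w sk) mkseqS ws cat_rcons next_supermartingale_cat.
by rewrite (@next_varE _ _ _ _ _ w) // /cylinder /= size_rcons mkseqS ws.
Qed.

Lemma next_var_le_supermartingale (M : seq X -> \bar R) :
  supermartingale Q M -> bounded_below M ->
  (forall w, cylinder s w -> f w <= path_liminf M w) ->
  forall x, next_var f s x <= M (rcons s x).
Proof.
move=> MQ Mb fM x.
have [w wsx Mw] := supermartingale_path (rcons s x) MQ Mb.
rewrite (next_varE f_meas wsx); apply: le_trans Mw; apply: fM.
(* The cylinder of [rcons s x] lies inside that of [s]. *)
by move: wsx; rewrite /cylinder /= size_rcons mkseqS => /rcons_inj[].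
Qed.

Lemma gt_upper_expectation_next_var :
  gt_upper_expectation Q f s = Q s (next_var f s).
Proof.
rewrite /gt_upper_expectation; apply/eqP; rewrite eq_le; apply/andP; split.
  apply: ereal_inf_lbound; exists next_supermartingale; last first.
    by have := next_supermartingale_cat [::]; rewrite cats0.
  split; [exact: next_supermartingaleP
    |exact: next_supermartingale_bounded_below
    |exact: next_supermartingale_liminf].
apply: le_ereal_inf_tmp => _ [M [MQ Mb fM] <-]; apply: le_trans (MQ s).
apply: (upexp_mono (HQ s)); [exact: next_var_bounded_below
  |exact: (bounded_below_comp (rcons s) Mb)
  |exact: next_var_le_supermartingale].
Qed.

End Supermartingales.

Theorem proposition14 (R : realType) (X : finType) (X_gt0 : (0 < #|X|)%N)
    (Q : seq X -> (X -> \bar R) -> \bar R)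
    (HQ : forall s : seq X, upper_expectation (Q s))
    (n : nat) (s : n.-tuple X) (f : (nat -> X) -> \bar R)
    (f_meas : finitely_measurable n.+1 f) (f_bnd : bounded_below f) :
  gt_upper_expectation Q f s = Q s (next_var f s).
Proof.
by apply: gt_upper_expectation_next_var => //; rewrite size_tuple.
Qed.
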